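(* Let $d\ge4$ be an even integer and, for $(a,b)\in\mathbb{R}^2$, let $$\rho_{a,b}=\frac{1-a-b}{d^2}I_d\otimes I_d+a|\omega_d\rangle\langle\omega_d|+\frac bd(I_d\otimes\Omega_d)F_d(I_d\otimes\Omega_d)^*.$$ Then $\rho_{a,b}$ is a separable quantum state if and only if $(a,b)\in\mathbb{S}_1$, and $\rho_{a,b}$ is a PPT quantum state if and only if $(a,b)\in\mathbb{T}$, where $$\mathbb{S}_1=\Big\{(a,b)\in\mathbb{R}^2:\ (1-d)a+b\le\tfrac1{d+1},\ \ a+(1-d)b\le\tfrac1{d+1},\ \ a+b\le\tfrac1{d+1}\Big\},$$ $$\mathbb{T}=\Big\{(a,b)\in\mathbb{R}^2:\ (1-d)a+b\le\tfrac1{d+1},\ \ a+(1-d)b\le\tfrac1{d+1},\ \ a+(1+d)b\le1,\ \ (1+d)a+b\le1\Big\}.$$ In particular, $\rho_{a,b}$ is PPT entangled in the parameter region $a+b>\frac1{d+1}$, $a+(1+d)b\le1$, $(1+d)a+b\le1$.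
   Context: $\Omega_d=\begin{pmatrix}0&I_{d/2}\\-I_{d/2}&0\end{pmatrix}$, $|\omega_d\rangle=\frac1{\sqrt d}\sum_{j=1}^d|jj\rangle$, $F_d=\sum_{i,j=1}^d|ij\rangle\langle ji|$. A quantum state is a positive semidefinite matrix of trace one. A state on $\mathbb{C}^d\otimes\mathbb{C}^d$ is separable if it is a convex combination of pure product states $|v\rangle\langle v|\otimes|w\rangle\langle w|$, entangled otherwise, and PPT if its partial transpose $(\mathrm{id}\otimes\top)(\rho)$ is positive semidefinite. *)

(* Defs.v *)
From mathcomp Require Import all_boot all_order all_algebra.
From mathcomp Require Import all_real_closed mxtens.
From mathcomp Require Import boolp classical_sets reals.
Set Implicit Arguments.
Unset Strict Implicit.
Unset Printing Implicit Defensive.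
Import Order.TTheory GRing.Theory Num.Theory.
Local Open Scope ring_scope.
Local Open Scope complex_scope.
Local Open Scope sesquilinear_scope.
Local Open Scope classical_set_scope.

(* Matrices are over R[i]; C^d (x) C^d is indexed by 'I_(d * d), through
   mxtens_index and mxtens_unindex, so that *t is the Kronecker product and
   A ^t* is the conjugate transpose. *)

Definition ket (R : realType) (d : nat) (i : 'I_d) : 'cV[R[i]]_d :=
  delta_mx i 0.

Definition ket2 (R : realType) (d : nat) (i j : 'I_d) : 'cV[R[i]]_(d * d) :=
  ket R i *t ket R j.

Definition omega (R : realType) (d : nat) : 'cV[R[i]]_(d * d) :=
  ((Num.sqrt d%:R)^-1)%:C *: \sum_(j < d) ket2 R j j.

Definition Flip (R : realType) (d : nat) : 'M[R[i]]_(d * d) :=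
  \sum_(i < d) \sum_(j < d) ket2 R i j *m (ket2 R j i) ^t*.

(* Given by its entries to avoid casting between 'M_(d./2 + d./2) and 'M_d;
   only meaningful for even d, see OmegaE. *)
Definition Omega (R : realType) (d : nat) : 'M[R[i]]_d :=
  \matrix_(i, j) ((j == i + d./2 :> nat)%N%:R - (i == j + d./2 :> nat)%N%:R).

Lemma OmegaE (R : realType) (m : nat) :
  Omega R (m + m) = block_mx 0 1%:M (- 1%:M) 0.
Proof.
have hm : (m + m)./2 = m by rewrite addnn doubleK.
apply/matrixP => i j; rewrite !mxE hm.
have lt_neq (x : 'I_m) y : (x == m + y :> nat)%N = false.
  by rewrite ltn_eqF // (leq_trans (ltn_ord x)) ?leq_addr.
have lt_neq2 (x : 'I_m) y : (x == m + y + m :> nat)%N = false.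
  by rewrite -addnA lt_neq.
case: splitP => k ->; rewrite !mxE; case: splitP => l ->; rewrite !mxE.
- by rewrite ![(_ + m)%N]addnC !lt_neq subrr.
- by rewrite lt_neq2 subr0 addnC eqn_add2r eq_sym.
- by rewrite lt_neq2 sub0r addnC eqn_add2r.
- by rewrite -!addnA !eqn_add2l ![(_ + m)%N]addnC !lt_neq subrr.
Qed.

Definition rho (R : realType) (d : nat) (a b : R) : 'M[R[i]]_(d * d) :=
  ((1 - a - b) / d%:R ^+ 2)%:C *: (1%:M *t 1%:M)
  + a%:C *: (omega R d *m (omega R d) ^t*)
  + (b / d%:R)%:C *: ((1%:M *t Omega R d) *m Flip R d
                      *m (1%:M *t Omega R d) ^t*).

(* In R[i], 0 <= z means that z is real and nonnegative. *)
Definition psdmx (R : realType) (n : nat) (A : 'M[R[i]]_n) : Prop :=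
  A \is hermsymmx /\ forall v : 'cV[R[i]]_n, 0 <= (v ^t* *m A *m v) 0 0.

Definition is_state (R : realType) (n : nat) (A : 'M[R[i]]_n) : Prop :=
  psdmx A /\ \tr A = 1.

Definition unit_vector (R : realType) (d : nat) (v : 'cV[R[i]]_d) : Prop :=
  (v ^t* *m v) 0 0 = 1.

Definition is_separable (R : realType) (d : nat) (A : 'M[R[i]]_(d * d)) :
    Prop :=
  exists (n : nat) (p : 'I_n -> R) (v w : 'I_n -> 'cV[R[i]]_d),
    [/\ forall k, 0 <= p k,
        \sum_(k < n) p k = 1,
        forall k, unit_vector (v k) /\ unit_vector (w k)
      & A = \sum_(k < n)
              (p k)%:C *: ((v k *m (v k) ^t*) *t (w k *m (w k) ^t*))].

Definition is_entangled (R : realType) (d : nat) (A : 'M[R[i]]_(d * d)) :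
    Prop :=
  ~ is_separable A.

Definition ptrans (R : realType) (d : nat) (A : 'M[R[i]]_(d * d)) :
    'M[R[i]]_(d * d) :=
  \matrix_(k, l)
    A (mxtens_index ((mxtens_unindex k).1, (mxtens_unindex l).2))
      (mxtens_index ((mxtens_unindex l).1, (mxtens_unindex k).2)).

Lemma ptrans_tens (R : realType) (d : nat) (A B : 'M[R[i]]_d) :
  ptrans (A *t B) = A *t B^T.
Proof. by apply/matrixP => k l; rewrite !mxE !mxtens_indexK. Qed.

Definition is_ppt (R : realType) (d : nat) (A : 'M[R[i]]_(d * d)) : Prop :=
  psdmx (ptrans A).

Definition S1_region (R : realType) (d : nat) : set (R * R) :=
  [set x | [/\ (1 - d%:R) * x.1 + x.2 <= 1 / (d%:R + 1),
               x.1 + (1 - d%:R) * x.2 <= 1 / (d%:R + 1)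
             & x.1 + x.2 <= 1 / (d%:R + 1)]].

Definition T_region (R : realType) (d : nat) : set (R * R) :=
  [set x | [/\ (1 - d%:R) * x.1 + x.2 <= 1 / (d%:R + 1),
               x.1 + (1 - d%:R) * x.2 <= 1 / (d%:R + 1),
               x.1 + (1 + d%:R) * x.2 <= 1
             & (1 + d%:R) * x.1 + x.2 <= 1]].

(* Main.v *)
Require Import Defs.
From mathcomp Require Import all_boot all_order all_algebra.
From mathcomp Require Import all_real_closed mxtens ring lra.
From mathcomp Require Import boolp classical_sets reals.
Set Implicit Arguments.
Unset Strict Implicit.
Unset Printing Implicit Defensive.
Import Order.TTheory GRing.Theory Num.Theory.
Local Open Scope ring_scope.
Local Open Scope sesquilinear_scope.

(* Write P for the projector on omega and Q = (1 (x) Omega) F (1 (x) Omega)^*.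
   Since Omega is antisymmetric with Omega^2 = -1, we have Q^2 = 1 and
   PQ = QP = -P, so rho_{a,b} is diagonalised by the projectors P,
   (1 - Q)/2 - P and (1 + Q)/2, and partial transposition exchanges the roles
   of a and b up to conjugation by 1 (x) Omega. This gives the PPT region.

   For unit vectors v and w, the product state v (x) w has expectations
   |<conj v, w>|^2 for dP and |<Omega v, w>|^2 for Q. As conj v and Omega v are
   orthogonal, Bessel's inequality shows that 1 - dP - Q is nonnegative on
   product states, whence a + b <= 1/(d+1) for separable rho_{a,b}; the other
   two inequalities hold because separable states are PPT. Conversely, for a
   complex projective 2-design {v}, averaging |v><v| (x) X_v, with X_v the
   projector on conj v, on Omega v, or on the complement of both, gives
   multiples of 1 + dP, 1 + Q and (d-1) - dP - Q, the three vertices of S_1. *)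

(** * Conjugate transposes and Kronecker-indexed sums *)

Lemma adjmxM (C : numClosedFieldType) m n p (A : 'M[C]_(m, n)) (B : 'M_(n, p)) :
  (A *m B) ^t* = B ^t* *m A ^t*.
Proof. by rewrite trmx_mul map_mxM. Qed.

Lemma adjmxD (C : numClosedFieldType) m n (A B : 'M[C]_(m, n)) :
  (A + B) ^t* = A ^t* + B ^t*.
Proof. by rewrite linearD map_mxD. Qed.

Lemma adjmxN (C : numClosedFieldType) m n (A : 'M[C]_(m, n)) :
  (- A) ^t* = - A ^t*.
Proof. by rewrite linearN map_mxN. Qed.

Lemma adjmxZ (C : numClosedFieldType) m n (a : C) (A : 'M[C]_(m, n)) :
  (a *: A) ^t* = a^* *: A ^t*.
Proof. by rewrite linearZ map_mxZ. Qed.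

Lemma adjmx_tens (C : numClosedFieldType) m n p q (A : 'M[C]_(m, n))
    (B : 'M_(p, q)) : (A *t B) ^t* = A ^t* *t B ^t*.
Proof. by rewrite trmx_tens map_mxT. Qed.

Lemma adjmx1 (C : numClosedFieldType) n : (1%:M : 'M[C]_n) ^t* = 1%:M.
Proof. by rewrite trmx1 map_mx1. Qed.

Lemma mx_scaleE (K : pzRingType) m n (a : K) (A : 'M[K]_(m, n)) i j :
  (a *: A) i j = a * A i j.
Proof. exact: mxE. Qed.

Lemma mx_oppE (V : zmodType) m n (A : 'M[V]_(m, n)) i j : (- A) i j = - A i j.
Proof. exact: mxE. Qed.

Lemma mx_subE (V : zmodType) m n (A B : 'M[V]_(m, n)) i j :
  (A - B) i j = A i j - B i j.
Proof. by rewrite !mxE. Qed.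

Lemma tensmx11 (R : comPzRingType) m n :
  (1%:M *t 1%:M : 'M[R]_(m * n)) = 1%:M.
Proof.
apply/matrixP => x y; case: (mxtens_indexP x) => i k.
case: (mxtens_indexP y) => j l.
rewrite tensmxE !mxE (can_eq (@mxtens_indexK _ _)).
by rewrite xpair_eqE -natrM mulnb.
Qed.

Lemma sum_mxtens (V : nmodType) m n (F : 'I_(m * n) -> V) :
  \sum_x F x = \sum_i \sum_k F (mxtens_index (i, k)).
Proof.
rewrite pair_big (reindex (@mxtens_index m n)) /=; last first.
  by exists (@mxtens_unindex m n) => ? _;
    rewrite (mxtens_indexK, mxtens_unindexK).
by apply: eq_bigr => -[].
Qed.

Lemma mxtensP (T : Type) m n p q (A B : 'M[T]_(m * n, p * q)) :
  (forall i k j l, A (mxtens_index (i, k)) (mxtens_index (j, l)) =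
                   B (mxtens_index (i, k)) (mxtens_index (j, l))) -> A = B.
Proof.
move=> AB; apply/matrixP => x y; case: (mxtens_indexP x) => i k.
by case: (mxtens_indexP y) => j l.
Qed.

Lemma tens_colE (R : pzRingType) m n (v : 'cV[R]_m) (w : 'cV[R]_n) i k z :
  (v *t w : 'cV_(m * n)) (mxtens_index (i, k)) z = v i 0 * w k 0.
Proof. by rewrite mxE mxtens_indexK !ord1. Qed.

Lemma sum_delta (R : pzSemiRingType) n (i : 'I_n) (F : 'I_n -> R) :
  \sum_j (i == j)%:R * F j = F i.
Proof.
rewrite (bigD1 i) //= eqxx mul1r big1 ?addr0 // => j /negPf ji.
by rewrite eq_sym ji mul0r.
Qed.

Lemma mxtrace_tens (K : pzRingType) m n (A : 'M[K]_m) (B : 'M[K]_n) :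
  \tr (A *t B) = \tr A * \tr B.
Proof.
rewrite /mxtrace sum_mxtens mulr_suml; apply: eq_bigr => i _.
by rewrite mulr_sumr; apply: eq_bigr => k _; rewrite tensmxE.
Qed.

(** * Entries, traces and relations of F, Omega, P and Q *)

Section Operators.
Local Open Scope complex_scope.
Variables (R : realType) (d : nat).
Local Notation C := R[i].
Local Notation ix := mxtens_index.
Local Notation Om := (Omega R d).

Lemma FlipE i k j l :
  Flip R d (ix (i, k)) (ix (j, l)) = (i == l)%:R * (k == j)%:R.
Proof.
rewrite /Flip summxE.
under eq_bigr => a _.
  rewrite summxE.
  under eq_bigr => b _.
    rewrite !mxE big_ord1 !mxE !mxtens_indexK /= !andbT !rmorphM !rmorph_nat.
    rewrite [_ * _ * _](_ : _ = (k == b)%:R *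
      ((j == b)%:R * ((i == a)%:R * (l == a)%:R))); last by ring.
  over.
  rewrite sum_delta.
  rewrite mulrCA.
over.
by rewrite sum_delta mulrC [j == k]eq_sym [l == i]eq_sym.
Qed.

Lemma omegaE i k z :
  omega R d (ix (i, k)) z = ((Num.sqrt d%:R)^-1)%:C * (i == k)%:R.
Proof.
rewrite /omega mxE summxE; congr (_ * _).
under eq_bigr => j _ do rewrite tens_colE !mxE !andbT.
by rewrite sum_delta eq_sym.
Qed.

Definition Pproj : 'M[C]_(d * d) := omega R d *m (omega R d) ^t*.
Definition Qflip : 'M[C]_(d * d) :=
  (1%:M *t Om) *m Flip R d *m (1%:M *t Om) ^t*.

Lemma PprojE i k j l :
  Pproj (ix (i, k)) (ix (j, l)) = d%:R^-1 * ((i == k)%:R * (j == l)%:R).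
Proof.
rewrite mxE big_ord1 omegaE 2!mxE omegaE rmorphM rmorph_nat /=.
rewrite mulrACA; congr (_ * _).
rewrite conj_Creal; last by apply/complex_realP; eexists.
by rewrite -rmorphM -invfM -expr2 sqr_sqrtr ?ler0n // fmorphV rmorph_nat.
Qed.

Lemma mulmx_FlipE m (A : 'M[C]_(m, d * d)) x j l :
  (A *m Flip R d) x (ix (j, l)) = A x (ix (l, j)).
Proof.
rewrite mxE sum_mxtens.
under eq_bigr => i _.
  under eq_bigr => k _.
    rewrite FlipE [i == l]eq_sym [k == j]eq_sym mulrCA [A _ _ * _]mulrC.
  over.
  rewrite -mulr_sumr sum_delta.
over.
by rewrite sum_delta.
Qed.

Lemma Flip_mulmxE n (A : 'M[C]_(d * d, n)) i k y :
  (Flip R d *m A) (ix (i, k)) y = A (ix (k, i)) y.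
Proof.
rewrite mxE sum_mxtens.
under eq_bigr => j _.
  under eq_bigr => l _ do rewrite FlipE -mulrA.
  rewrite sum_delta.
over.
by rewrite sum_delta.
Qed.

Lemma Flip_tens (A B : 'M[C]_d) : Flip R d *m (A *t B) = (B *t A) *m Flip R d.
Proof.
apply: mxtensP => i k j l.
by rewrite mulmx_FlipE Flip_mulmxE !tensmxE mulrC.
Qed.

Lemma Flip_sqr : Flip R d *m Flip R d = 1%:M.
Proof.
apply: mxtensP => i k j l; rewrite mulmx_FlipE FlipE mxE.
by rewrite (can_eq (@mxtens_indexK _ _)) xpair_eqE -natrM mulnb.
Qed.

Lemma adj_Flip : (Flip R d) ^t* = Flip R d.
Proof.
apply: mxtensP => i k j l.
by rewrite 2!mxE !FlipE rmorphM !rmorph_nat mulrC [l == i]eq_sym [j == k]eq_sym.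
Qed.

Lemma tr_Flip : \tr (Flip R d) = d%:R.
Proof.
rewrite /mxtrace sum_mxtens.
under eq_bigr => i _.
  under eq_bigr => k _ do rewrite FlipE.
  rewrite sum_delta eqxx.
over.
by rewrite sumr_const card_ord.
Qed.

Lemma adj_Omega : Om ^t* = - Om.
Proof.
by apply/matrixP => i j; rewrite !mxE rmorphB !rmorph_nat opprB.
Qed.

Lemma Omega_antisym i j : Om j i = - Om i j.
Proof. by rewrite !mxE opprB. Qed.

Lemma adj_Pproj : Pproj ^t* = Pproj.
Proof. by rewrite adjmxM trmxCK. Qed.

Lemma adj_Qflip : Qflip ^t* = Qflip.
Proof. by rewrite /Qflip 2!adjmxM trmxCK adj_Flip mulmxA. Qed.

(** Moving F past the right factor gives Q = (Omega^* (x) Omega) F. The sign in Omega^* = - Omega is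
    absorbed by swapping the indices of the antisymmetric [Om i l]. *)
Lemma QflipE i k j l : Qflip (ix (i, k)) (ix (j, l)) = Om l i * Om k j.
Proof.
rewrite /Qflip adjmx_tens adjmx1 -mulmxA Flip_tens mulmxA tensmx_mul.
rewrite mul1mx mulmx1 mulmx_FlipE tensmxE adj_Omega.
by rewrite [Om l i]Omega_antisym mxE.
Qed.

Hypothesis (hd : (4 <= d)%N) (hev : ~~ odd d).

Lemma Omega_sqr : Om *m Om = - 1%:M.
Proof.
have [m ->] : exists m, d = (m + m)%N.
  by exists d./2; rewrite addnn even_halfK.
rewrite OmegaE mulmx_block !mulmx0 !mul0mx !mul1mx !mulmx1 addr0 !add0r.
by rewrite scalar_mx_block opp_block_mx !oppr0 addr0.
Qed.

Let V : 'M[C]_(d * d) := 1%:M *t Om.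

Lemma adj_Omega_mul : Om ^t* *m Om = 1%:M.
Proof. by rewrite adj_Omega mulNmx Omega_sqr opprK. Qed.

Lemma Omega_mul_adj : Om *m Om ^t* = 1%:M.
Proof. by rewrite adj_Omega mulmxN Omega_sqr opprK. Qed.

Lemma adj_V_mul : V ^t* *m V = 1%:M.
Proof.
by rewrite adjmx_tens tensmx_mul adj_Omega_mul adjmx1 mulmx1 tensmx11.
Qed.

Lemma V_mul_adj : V *m V ^t* = 1%:M.
Proof.
by rewrite adjmx_tens tensmx_mul Omega_mul_adj adjmx1 mulmx1 tensmx11.
Qed.

Lemma Qflip_sqr : Qflip *m Qflip = 1%:M.
Proof.
rewrite /Qflip -/V !mulmxA -[_ *m V ^t* *m V]mulmxA adj_V_mul mulmx1.
by rewrite -[_ *m Flip R d *m Flip R d]mulmxA Flip_sqr mulmx1 V_mul_adj.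
Qed.

Lemma tr_Qflip : \tr Qflip = d%:R.
Proof. by rewrite /Qflip -/V mxtrace_mulC mulmxA adj_V_mul mul1mx tr_Flip. Qed.

Lemma d_neq0 : d%:R != 0 :> C.
Proof. by rewrite pnatr_eq0 -lt0n (leq_trans _ hd). Qed.

Lemma Pproj_sqr : Pproj *m Pproj = Pproj.
Proof.
apply: mxtensP => i k j l; rewrite mxE sum_mxtens.
under eq_bigr => i' _.
  under eq_bigr => k' _.
    rewrite !PprojE [_ * _](_ : _ = (i' == k')%:R *
      (d%:R ^- 2 * (i == k)%:R * (j == l)%:R)).
      over.
    by rewrite expr2 invfM; case: (i' == k') => /=; ring.
  rewrite sum_delta.
over.
rewrite sumr_const card_ord PprojE -mulr_natr; field; exact: d_neq0.
Qed.

Lemma tr_Pproj : \tr Pproj = 1.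
Proof.
rewrite /mxtrace sum_mxtens.
under eq_bigr => i _.
  under eq_bigr => k _ do rewrite PprojE mulrCA.
  rewrite sum_delta eqxx mulr1.
over.
by rewrite sumr_const card_ord -[LHS]mulr_natr mulVf // d_neq0.
Qed.

(** The entries of P vanish unless the two row indices agree, so the product contracts the two Omega
    factors of Q to Omega^2 = -1. *)
Lemma Qflip_Pproj : Qflip *m Pproj = - Pproj.
Proof.
apply: mxtensP => i k j l; rewrite [RHS]mxE mxE sum_mxtens.
transitivity ((d%:R^-1 * (j == l)%:R) * (Om *m Om) k i).
  rewrite mxE mulr_sumr; apply: eq_bigr => i' _.
  under eq_bigr => k' _.
    rewrite QflipE PprojE [_ * _](_ : _ = (i' == k')%:R *
      (Om k' i * (Om k i' * (d%:R^-1 * (j == l)%:R)))); last by ring.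
  over.
  by rewrite sum_delta; ring.
rewrite Omega_sqr PprojE !mxE [k == i]eq_sym; ring.
Qed.

Lemma Pproj_Qflip : Pproj *m Qflip = - Pproj.
Proof.
rewrite -{1}adj_Pproj -{1}adj_Qflip -adjmxM Qflip_Pproj.
by rewrite adjmxN adj_Pproj.
Qed.

End Operators.

(* P lies below the (-1)-eigenprojector of Q, so 1 + Q, 1 - Q - 2P and P are,
   up to scaling, complementary orthogonal projectors. *)
Section ProjectorAlgebra.
Variables (K : comPzRingType) (n : nat) (P Q : 'M[K]_n).
Hypotheses (PP : P *m P = P) (QQ : Q *m Q = 1%:M).
Hypotheses (PQ : P *m Q = - P) (QP : Q *m P = - P).

Let mulE := (mulr2n, mulmxDl, mulmxDr, mulmxN, mulNmx, mul1mx, mulmx1,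
  PP, QQ, PQ, QP, =^~ scalemxAl, =^~ scalemxAr).

Lemma projp_sqr : (1%:M + Q) *m (1%:M + Q) = (1%:M + Q) *+ 2.
Proof. by rewrite !mulE; apply/matrixP => i j; rewrite !mxE; ring. Qed.

Lemma projm_sqr :
  (1%:M - Q - P *+ 2) *m (1%:M - Q - P *+ 2) = (1%:M - Q - P *+ 2) *+ 2.
Proof. by rewrite !mulE; apply/matrixP => i j; rewrite !mxE; ring. Qed.

(** Here 2x, 2y and z are the eigenvalues on the ranges of (1 + Q)/2, (1 - Q)/2 - P and P. *)
Lemma proj_decomp (x y z : K) :
  x *: (1%:M + Q) + y *: (1%:M - Q - P *+ 2) + z *: P =
  (x + y) *: 1%:M + (z - y *+ 2) *: P + (x - y) *: Q.
Proof. by rewrite !mulr2n; apply/matrixP => i j; rewrite !mxE; ring. Qed.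

(** Compressing to an eigenspace isolates its eigenvalue, here c - q, and c + p - q in
    [Pproj_mul]. *)
Lemma projm_mul (c p q : K) :
  (1%:M - Q - P *+ 2) *m (c *: 1%:M + p *: P + q *: Q) *m (1%:M - Q - P *+ 2) =
  ((c - q) *+ 2) *: (1%:M - Q - P *+ 2).
Proof. by rewrite !mulE; apply/matrixP => i j; rewrite !mxE; ring. Qed.

Lemma Pproj_mul (c p q : K) :
  P *m (c *: 1%:M + p *: P + q *: Q) *m P = (c + p - q) *: P.
Proof. by rewrite !mulE; apply/matrixP => i j; rewrite !mxE; ring. Qed.

End ProjectorAlgebra.

(** * Positive semidefinite matrices and the span of 1, P and Q *)

Section PositiveSemidefinite.
Local Open Scope complex_scope.
Variable R : realType.
Local Notation C := R[i].

Lemma hermsymmxE n (A : 'M[C]_n) : A \is hermsymmx = (A ^t* == A).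
Proof. by rewrite is_hermitianmxE expr0 scale1r eq_sym. Qed.

Lemma conj_real_complex (a : R) : (a%:C)^*%R = a%:C :> C.
Proof. exact: conjc_real. Qed.

Lemma adj_mul_ge0 n (v : 'cV[C]_n) : 0 <= (v ^t* *m v) 0 0.
Proof.
by rewrite mxE sumr_ge0 // => i _; rewrite !mxE mulrC mul_conjC_ge0.
Qed.

Lemma adj_mul_eq0 n (v : 'cV[C]_n) : (v ^t* *m v) 0 0 = 0 -> v = 0.
Proof.
rewrite mxE => /eqP; rewrite psumr_eq0 => [/allP v0|i _]; last first.
  by rewrite !mxE mulrC mul_conjC_ge0.
apply/matrixP => i j; rewrite ord1 mxE.
have := v0 i (mem_index_enum _); rewrite !mxE /= mulrC mul_conjC_eq0.
by move/eqP.
Qed.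

Lemma psdmx_adj_mul m n (B : 'M[C]_(m, n)) : psdmx (B ^t* *m B).
Proof.
split=> [|v]; first by rewrite hermsymmxE adjmxM trmxCK.
by rewrite mulmxA -adjmxM -mulmxA adj_mul_ge0.
Qed.

Lemma psdmx_mul_adj m n (B : 'M[C]_(m, n)) : psdmx (B *m B ^t*).
Proof. by rewrite -{1}[B]trmxCK; apply: psdmx_adj_mul. Qed.

Lemma psdmxD n (A B : 'M[C]_n) : psdmx A -> psdmx B -> psdmx (A + B).
Proof.
move=> [hA pA] [hB pB]; split=> [|v].
  by move: hA hB; rewrite !hermsymmxE adjmxD => /eqP -> /eqP ->.
by rewrite mulmxDr mulmxDl mxE addr_ge0.
Qed.

Lemma psdmxZ n (a : R) (A : 'M[C]_n) :
  0 <= a -> psdmx A -> psdmx (a%:C *: A).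
Proof.
move=> a0 [hA pA]; split=> [|v].
  by move: hA; rewrite !hermsymmxE adjmxZ conj_real_complex => /eqP ->.
by rewrite -scalemxAr -scalemxAl mxE mulr_ge0 // ler0c.
Qed.

Lemma psdmx_sum (I : Type) (s : seq I) n (F : I -> 'M[C]_n) :
  (forall x, psdmx (F x)) -> psdmx (\sum_(x <- s) F x).
Proof.
move=> psdF; apply: (big_ind (@psdmx R n)) => [|A B|x _].
- by have := psdmx_adj_mul (0 : 'M[C]_n); rewrite mulmx0.
- exact: psdmxD.
- exact: psdF.
Qed.

Lemma psdmx_congr m n (A : 'M[C]_m) (B : 'M[C]_(m, n)) :
  psdmx A -> psdmx (B ^t* *m A *m B).
Proof.
move=> [hA pA]; split=> [|v].
  by move: hA; rewrite !hermsymmxE 2!adjmxM trmxCK mulmxA => /eqP ->.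
by have := pA (B *m v); rewrite adjmxM !mulmxA.
Qed.

Lemma psdmx_tr_ge0 n (A : 'M[C]_n) : psdmx A -> 0 <= \tr A.
Proof.
move=> [_ pA]; apply: sumr_ge0 => i _; have := pA (delta_mx i 0).
rewrite trmx_delta map_delta_mx -rowE mxE.
under eq_bigr => j _ do rewrite !mxE eqxx andbT mulrC [j == i]eq_sym.
by rewrite sum_delta.
Qed.

Section TwoParameterFamily.
Variables (n : nat) (P Q : 'M[C]_n).
Hypotheses (adjP : P ^t* = P) (adjQ : Q ^t* = Q).
Hypotheses (PP : P *m P = P) (QQ : Q *m Q = 1%:M).
Hypotheses (PQ : P *m Q = - P) (QP : Q *m P = - P).

Let adj_projp : (1%:M + Q) ^t* = 1%:M + Q.
Proof. by rewrite adjmxD adjmx1 adjQ. Qed.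

Let adj_projm : (1%:M - Q - P *+ 2) ^t* = 1%:M - Q - P *+ 2.
Proof. by rewrite mulr2n !(adjmxD, adjmxN) adjmx1 adjQ adjP. Qed.

(** Such an E is twice an orthogonal projector, and E = (E^* E) / 2. *)
Let psdmx_proj2 (E : 'M[C]_n) : E ^t* = E -> E *m E = E *+ 2 -> psdmx E.
Proof.
move=> adjE EE; have := psdmxZ (a := 2^-1) _ (psdmx_adj_mul E).
rewrite adjE EE -scaler_nat scalerA fmorphV rmorph_nat mulVf ?pnatr_eq0 //.
by rewrite scale1r; apply; rewrite invr_ge0.
Qed.

(** The three hypotheses are nonnegativity of the eigenvalues on the ranges of (1 + Q)/2, (1 - Q)/2
    - P and P. *)
Lemma psdmx_span (c p q : R) : 0 <= c + q -> 0 <= c - q -> 0 <= c + p - q ->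
  psdmx (c%:C *: 1%:M + p%:C *: P + q%:C *: Q).
Proof.
move=> l1 l2 l3; pose x := (c + q) / 2; pose y := (c - q) / 2.
have [cE pE qE] : [/\ c = x + y, p = (c + p - q) - y *+ 2 & q = x - y].
  by rewrite /x /y; split; field.
have -> : c%:C *: 1%:M + p%:C *: P + q%:C *: Q = x%:C *: (1%:M + Q) +
    y%:C *: (1%:M - Q - P *+ 2) + (c + p - q)%:C *: P.
  by rewrite proj_decomp -rmorphMn -!rmorphB -rmorphD -cE -pE -qE.
have psd1 := psdmx_proj2 adj_projp (projp_sqr QQ).
have psd2 := psdmx_proj2 adj_projm (projm_sqr PP QQ PQ QP).
have psd3 : psdmx P by rewrite -PP -{1}adjP; apply: psdmx_adj_mul.
apply: psdmxD; first by apply: psdmxD; apply: psdmxZ => //; rewrite divr_ge0.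
exact: psdmxZ.
Qed.

(** Compression by an eigenprojector preserves positivity, and the trace of the result is a positive
    multiple of the eigenvalue. *)
Lemma psdmx_span_inv (c p q : R) :
    psdmx (c%:C *: 1%:M + p%:C *: P + q%:C *: Q) ->
    0 < \tr (1%:M - Q - P *+ 2) -> 0 < \tr P ->
  0 <= c - q /\ 0 <= c + p - q.
Proof.
move=> psdM tr2 trP; split.
  have := psdmx_tr_ge0 (psdmx_congr (1%:M - Q - P *+ 2) psdM).
  rewrite adj_projm (projm_mul PP QQ PQ QP) linearZ /= pmulr_lge0 //.
  by rewrite -rmorphB -rmorphMn ler0c pmulrn_lge0.
have := psdmx_tr_ge0 (psdmx_congr P psdM).
rewrite adjP (Pproj_mul PP PQ) linearZ /= pmulr_lge0 //.
by rewrite -rmorphD -rmorphB ler0c.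
Qed.

End TwoParameterFamily.
End PositiveSemidefinite.

(** * Partial transposition and the PPT condition *)

Lemma mulmx_span3 (K : comPzRingType) n (A B P Q : 'M[K]_n) (c p q : K) :
  A *m (c *: 1%:M + p *: P + q *: Q) *m B =
  c *: (A *m B) + p *: (A *m P *m B) + q *: (A *m Q *m B).
Proof.
by rewrite !(mulmxDr, mulmxDl) -!(scalemxAr, scalemxAl) mulmx1.
Qed.

Section PartialTranspose.
Local Open Scope complex_scope.
Variables (R : realType) (d : nat).
Local Notation C := R[i].
Local Notation ix := mxtens_index.
Local Notation Om := (Omega R d).
Local Notation P := (Pproj R d).
Local Notation Q := (Qflip R d).
Local Notation V := (1%:M *t Om : 'M[C]_(d * d)).

Lemma tens1mx_mulE n (B : 'M[C]_d) (A : 'M[C]_(d * d, n)) i k y :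
  ((1%:M *t B) *m A) (ix (i, k)) y = \sum_k' B k k' * A (ix (i, k')) y.
Proof.
rewrite mxE sum_mxtens.
under eq_bigr => i' _.
  under eq_bigr => k' _ do rewrite tensmxE mxE -mulrA.
  rewrite -mulr_sumr.
over.
by rewrite sum_delta.
Qed.

Lemma mulmx_tens1mxE n (B : 'M[C]_d) (A : 'M[C]_(n, d * d)) x j l :
  (A *m (1%:M *t B)) x (ix (j, l)) = \sum_l' A x (ix (j, l')) * B l' l.
Proof.
rewrite mxE sum_mxtens.
under eq_bigr => i' _.
  under eq_bigr => k' _ do rewrite tensmxE mxE [i' == j]eq_sym mulrCA.
  rewrite -mulr_sumr.
over.
by rewrite sum_delta.
Qed.

Lemma ptransE (A : 'M[C]_(d * d)) i k j l :
  ptrans A (ix (i, k)) (ix (j, l)) = A (ix (i, l)) (ix (j, k)).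
Proof. by rewrite mxE !mxtens_indexK. Qed.

Lemma ptransD (A B : 'M[C]_(d * d)) : ptrans (A + B) = ptrans A + ptrans B.
Proof. by apply/matrixP => x y; rewrite !mxE. Qed.

Lemma ptransZ (a : C) (A : 'M[C]_(d * d)) : ptrans (a *: A) = a *: ptrans A.
Proof. by apply/matrixP => x y; rewrite !mxE. Qed.

Lemma ptrans1 : ptrans (1%:M : 'M[C]_(d * d)) = 1%:M.
Proof. by rewrite -tensmx11 ptrans_tens trmx1. Qed.

Lemma ptrans_Pproj : ptrans P = d%:R^-1 *: Flip R d.
Proof.
apply: mxtensP => i k j l.
by rewrite ptransE [RHS]mxE PprojE FlipE [j == k]eq_sym.
Qed.

Hypothesis (hd : (4 <= d)%N) (hev : ~~ odd d).

(** After the exchange of k and l, the entries of Q factor into a function of (i, k) times a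
    function of (j, l). The result thus has rank one, spanned by the image of omega under the
    adjoint of V. *)
Lemma ptrans_Qflip : ptrans Q = d%:R *: (V ^t* *m P *m V).
Proof.
apply: mxtensP => i k j l; rewrite ptransE QflipE [RHS]mxE.
rewrite adjmx_tens adjmx1 mulmx_tens1mxE adj_Omega.
transitivity (d%:R * (- (d%:R^-1 * Om k i) * Om j l)); last first.
  congr (_ * _); rewrite -(sum_delta j (fun l' => _ * Om l' l)).
  apply: eq_bigr => l' _; rewrite tens1mx_mulE mulrA; congr (_ * _).
  rewrite -(sum_delta i (fun k' => - (_ * Om k k'))) mulr_sumr.
  by apply: eq_bigr => k' _; rewrite PprojE mx_oppE; ring.
rewrite [Om j l]Omega_antisym; field; exact: d_neq0.
Qed.

Lemma rhoE (a b : R) : rho d a b =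
  ((1 - a - b) / d%:R ^+ 2)%:C *: 1%:M + a%:C *: P + (b / d%:R)%:C *: Q.
Proof. by rewrite /rho tensmx11. Qed.

(** Since F = V^* Q V, partial transposition sends P to Q/d and Q to dP up to conjugation by the
    unitary V. The weights a of P and b/d of Q are scaled so that this exchanges a and b. *)
Lemma ptrans_rho (a b : R) : ptrans (rho d a b) = V ^t* *m rho d b a *m V.
Proof.
have QV : V ^t* *m Q *m V = Flip R d.
  rewrite /Qflip; have := adj_V_mul R hev; move: V (Flip _ _) => W F WW.
  by rewrite !mulmxA WW mul1mx -mulmxA WW mulmx1.
rewrite !rhoE !ptransD !ptransZ ptrans1 ptrans_Pproj ptrans_Qflip.
rewrite mulmx_span3 QV (adj_V_mul R hev) !scalerA.
have -> : a%:C / d%:R = (a / d%:R)%:C by rewrite rmorphM fmorphV rmorph_nat.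
have -> : (b / d%:R)%:C * d%:R = b%:C.
  by rewrite rmorphM fmorphV rmorph_nat divfK // d_neq0.
have -> : 1 - b - a = 1 - a - b by ring.
exact: addrAC.
Qed.

Lemma tr_rho (a b : R) : \tr (rho d a b) = 1.
Proof.
rewrite rhoE !linearD !linearZ /= mxtrace1 tr_Pproj // tr_Qflip //.
have dE : (d%:R : C) = (d%:R : R)%:C by rewrite rmorph_nat.
have := d_neq0 R hd; rewrite dE fmorph_eq0 => d0.
rewrite natrM dE mulr1.
rewrite -!rmorphM -!rmorphD -[RHS](rmorph1 (real_complex R)); congr (_%:C).
by field.
Qed.

Lemma is_ppt_rho (a b : R) : is_ppt (rho d a b) <-> psdmx (rho d b a).
Proof.
rewrite /is_ppt ptrans_rho; split=> [|h]; last exact: psdmx_congr.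
have := V_mul_adj R hev; move: V (rho _ _ _) => W A WW.
move=> /(psdmx_congr (W ^t*)); rewrite trmxCK.
by rewrite !mulmxA WW mul1mx -mulmxA WW mulmx1.
Qed.

Lemma d_gt0 : 0 < d%:R :> R.
Proof. by rewrite ltr0n (leq_trans _ hd). Qed.

(** The hypotheses are the three eigenvalues of [rho d a b], multiplied by d^2. *)
Lemma psdmx_rho (a b : R) :
    0 <= 1 - a - b + d%:R * b -> 0 <= 1 - a - b - d%:R * b ->
    0 <= 1 - a - b + d%:R ^+ 2 * a - d%:R * b ->
  psdmx (rho d a b).
Proof.
move=> l1 l2 l3.
have d0 : d%:R != 0 :> R by rewrite gt_eqF // d_gt0.
rewrite rhoE; apply: psdmx_span; rewrite ?adj_Pproj ?adj_Qflip ?Pproj_sqr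
  ?Qflip_sqr ?Pproj_Qflip ?Qflip_Pproj // -(pmulr_rge0 _ (exprn_gt0 2 d_gt0)).
- by rewrite [X in 0 <= X](_ : _ = 1 - a - b + d%:R * b) //; field.
- by rewrite [X in 0 <= X](_ : _ = 1 - a - b - d%:R * b) //; field.
- rewrite [X in 0 <= X](_ : _ = 1 - a - b + d%:R ^+ 2 * a - d%:R * b) //.
  by field.
Qed.

(** After expansion these are two of the four inequalities of T; the other two arise from
    [rho d b a]. *)
Lemma psdmx_rho_inv (a b : R) : psdmx (rho d a b) ->
  0 <= 1 - a - b - d%:R * b /\ 0 <= 1 - a - b + d%:R ^+ 2 * a - d%:R * b.
Proof.
have d0 : d%:R != 0 :> R by rewrite gt_eqF // d_gt0.
rewrite rhoE => /psdmx_span_inv; rewrite ?adj_Pproj ?adj_Qflip ?Pproj_sqr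
  ?Qflip_sqr ?Pproj_Qflip ?Qflip_Pproj //.
case=> //.
- rewrite mulr2n !(linearD, linearN) /= tr_Pproj // tr_Qflip // mxtrace1.
  (* The trace factors as (d - 2)(d + 1). *)
  rewrite [X in 0 < X](_ : _ = (d%:R ^+ 2 - d%:R - 2)%:C); last first.
    by rewrite !rmorphB rmorphXn !rmorph_nat natrM; ring.
  have d4 : 4 <= d%:R :> R by rewrite ler_nat.
  by rewrite ltcR; nra.
- by rewrite tr_Pproj // ltr01.
have d2 := exprn_ge0 2 (ltW d_gt0).
move=> /(mulr_ge0 d2) l2 /(mulr_ge0 d2) l3; split.
  rewrite [X in 0 <= X](_ : _ = 1 - a - b - d%:R * b) in l2; first exact: l2.
  by field.
rewrite [X in 0 <= X](_ : _ = 1 - a - b + d%:R ^+ 2 * a - d%:R * b) in l3.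
  exact: l3.
by field.
Qed.

End PartialTranspose.

(** * The cone of unnormalised separable matrices, and Bessel's inequality *)

Section SeparableCone.
Local Open Scope complex_scope.
Variables (R : realType) (d : nat).
Local Notation C := R[i].

Lemma outerZ (a : C) n (v : 'cV[C]_n) :
  (a *: v) *m (a *: v) ^t* = (`|a| ^+ 2) *: (v *m v ^t*).
Proof. by rewrite adjmxZ -scalemxAl -scalemxAr scalerA normCK. Qed.

Definition prodmx (v w : 'cV[C]_d) : 'M[C]_(d * d) :=
  (v *m v ^t*) *t (w *m w ^t*).

(** Weights and norms are absorbed into the vectors, so that sums and nonnegative multiples can be
    formed freely; normalisation is deferred to [sepcone_separable]. *)
Definition sepcone (A : 'M[C]_(d * d)) : Prop :=
  exists s : seq ('cV[C]_d * 'cV[C]_d), A = \sum_(x <- s) prodmx x.1 x.2.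

Lemma sepcone_prodmx v w : sepcone (prodmx v w).
Proof. by exists [:: (v, w)]; rewrite big_seq1. Qed.

Lemma sepconeD A B : sepcone A -> sepcone B -> sepcone (A + B).
Proof. by move=> [s ->] [t ->]; exists (s ++ t); rewrite big_cat. Qed.

Lemma sepcone_sum (I : Type) (s : seq I) (F : I -> 'M[C]_(d * d)) :
  (forall x, sepcone (F x)) -> sepcone (\sum_(x <- s) F x).
Proof.
move=> coneF; elim: s => [|x s IHs]; first by exists [::]; rewrite !big_nil.
by rewrite big_cons; apply: sepconeD.
Qed.

Lemma sepconeZ (a : R) A : 0 <= a -> sepcone A -> sepcone (a%:C *: A).
Proof.
move=> a0 [s ->]; exists [seq ((Num.sqrt a)%:C *: x.1, x.2) | x <- s].
rewrite big_map scaler_sumr; apply: eq_bigr => x _.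
rewrite /prodmx outerZ ger0_norm ?ler0c ?sqrtr_ge0 // -rmorphXn sqr_sqrtr //.
apply: mxtensP => i k j l.
by rewrite mxE !tensmxE mx_scaleE mulrA.
Qed.

Let sqn (v : 'cV[C]_d) : C := (v ^t* *m v) 0 0.

Lemma outer_unit (v : 'cV[C]_d) : (0 < d)%N ->
  exists u, unit_vector u /\ v *m v ^t* = sqn v *: (u *m u ^t*).
Proof.
move=> d_gt0; have [v0|v_neq0] := eqVneq (sqn v) 0.
  (* For v = 0 any unit vector serves, since its weight is zero. *)
  exists (delta_mx (Ordinal d_gt0) 0); split.
    by rewrite /unit_vector trmx_delta map_delta_mx mul_delta_mx mxE !eqxx.
  by rewrite v0 scale0r (adj_mul_eq0 v0) mul0mx.
have r_gt0 : 0 < sqrtC (sqn v).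
  by rewrite sqrtC_gt0 lt_def v_neq0 adj_mul_ge0.
have nE : `|(sqrtC (sqn v))^-1| ^+ 2 = (sqn v)^-1.
  by rewrite ger0_norm ?invr_ge0 ?ltW // exprVn sqrtCK.
exists ((sqrtC (sqn v))^-1 *: v); split.
  rewrite /unit_vector adjmxZ -scalemxAl -scalemxAr scalerA mulrC -normCK nE.
  by rewrite mxE mulVf.
by rewrite outerZ nE scalerA divff // scale1r.
Qed.

Lemma tr_outer (v : 'cV[C]_d) : \tr (v *m v ^t*) = sqn v.
Proof. by rewrite mxtrace_mulC /mxtrace big_ord1. Qed.

(** Each vector is normalised and the squared norms become the weights. Products of unit vectors
    have trace one, so the weights sum to the trace of A. *)
Lemma sepcone_separable (A : 'M[C]_(d * d)) :
  (0 < d)%N -> sepcone A -> \tr A = 1 -> is_separable A.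
Proof.
move=> d_gt0 [s AE] trA.
have [f fP] := choice (fun v => outer_unit v d_gt0).
pose n (v : 'cV[C]_d) : R := complex.Re (sqn v).
have nE v : sqn v = (n v)%:C.
  by rewrite RRe_real // ger0_real // adj_mul_ge0.
have n0 v : 0 <= n v by rewrite -ler0c -nE adj_mul_ge0.
have tr1 v : \tr (f v *m (f v) ^t*) = 1.
  by rewrite tr_outer; have [] := fP v.
have prodE v w : prodmx v w = (n v * n w)%:C *: prodmx (f v) (f w).
  rewrite /prodmx (fP v).2 (fP w).2 !nE; apply: mxtensP => i k j l.
  rewrite mx_scaleE !tensmxE !mx_scaleE rmorphM.
  exact: mulrACA.
pose x k := nth (0, 0) s k.
exists (size s), (fun k => n (x k).1 * n (x k).2), (fun k => f (x k).1),
  (fun k => f (x k).2).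
have AE' : A = \sum_(k < size s) (n (x k).1 * n (x k).2)%:C *:
    prodmx (f (x k).1) (f (x k).2).
  rewrite AE (big_nth (0, 0)) big_mkord.
  by apply: eq_bigr => k _; rewrite prodE.
split=> [k||k|//].
- by rewrite mulr_ge0.
- apply: complexI; rewrite rmorph_sum rmorph1 -[RHS]trA AE' linear_sum.
  apply: eq_bigr => k _ /=.
  by rewrite linearZ /= mxtrace_tens !tr1 !mulr1.
- by split; [case: (fP (x k).1)|case: (fP (x k).2)].
Qed.

Lemma outer_sum_col n m (M : 'M[C]_(n, m)) :
  M *m M ^t* = \sum_j col j M *m (col j M) ^t*.
Proof.
apply/matrixP => i k; rewrite mxE summxE; apply: eq_bigr => j _.
by rewrite [RHS]mxE big_ord1 !mxE.
Qed.

Lemma tensmx_sumr m n p (I : Type) (s : seq I) (A : 'M[C]_(m, n))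
    (F : I -> 'M[C]_p) :
  A *t (\sum_(x <- s) F x) = \sum_(x <- s) A *t F x.
Proof.
apply: mxtensP => i k j l; rewrite tensmxE !summxE mulr_sumr.
by apply: eq_bigr => x _; rewrite tensmxE.
Qed.

(** The factor M M^* splits into the outer products of the columns of M, so a Gram factorisation
    replaces a spectral decomposition. *)
Lemma sepcone_gram m (v : 'cV[C]_d) (M : 'M[C]_(d, m)) :
  sepcone ((v *m v ^t*) *t (M *m M ^t*)).
Proof.
rewrite (outer_sum_col M) tensmx_sumr; apply: sepcone_sum => j.
exact: sepcone_prodmx.
Qed.

Definition conjv (v : 'cV[C]_d) : 'cV[C]_d := map_mx Num.conj v.

(* Up to the factor [|v|^2], the projector onto the complement of conj v and
   Omega v, which are orthogonal because Omega is antisymmetric. *)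
Definition besselmx (v : 'cV[C]_d) : 'M[C]_d :=
  sqn v *: 1%:M - conjv v *m (conjv v) ^t*
  - (Omega R d *m v) *m (Omega R d *m v) ^t*.

Hypothesis hev : ~~ odd d.

(** B annihilates x and y, so multiplying B by itself leaves only the term N of the second
    factor. *)
Lemma bessel_sqr n (x y : 'cV[C]_n) (N : C) : N^*%R = N ->
    x ^t* *m x = N%:M -> y ^t* *m y = N%:M -> x ^t* *m y = 0 ->
    y ^t* *m x = 0 ->
  let B := N *: 1%:M - x *m x ^t* - y *m y ^t* in B *m B ^t* = N *: B.
Proof.
move=> Nr xx yy xy yx B.
have adjB : B ^t* = B.
  by rewrite /B !(adjmxD, adjmxN, adjmxZ, adjmxM, trmxCK) adjmx1 Nr.
have Bx : B *m x = 0.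
  rewrite !mulmxBl -scalemxAl mul1mx -!mulmxA xx yx mulmx0 subr0.
  by rewrite mul_mx_scalar subrr.
have By : B *m y = 0.
  rewrite !mulmxBl -scalemxAl mul1mx -!mulmxA xy yy mulmx0 subr0.
  by rewrite mul_mx_scalar subrr.
by rewrite adjB {2}/B !mulmxBr -scalemxAr mulmx1 !mulmxA Bx By !mul0mx !subr0.
Qed.

(** The Gram form serves twice: it makes the witness nonnegative on product states, and it puts the
    third generator in the separable cone. *)
Lemma besselmx_gram v : exists M : 'M[C]_d, besselmx v = M *m M ^t*.
Proof.
have N0 : 0 <= sqn v := adj_mul_ge0 v.
have sc (A : 'M[C]_1) : A = (A 0 0)%:M by apply: mx11_scalar.
have anti : v ^T *m Omega R d *m v = 0.
  (* S is a 1 x 1 matrix, hence equal to its transpose, while antisymmetry of Omega makes the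
     transpose equal to - S. *)
  set S := _ *m v; have ST : S ^T = - S.
    rewrite /S !trmx_mul trmxK mulmxA -mulNmx -mulmxN; congr (_ *m _ *m _).
    by apply/matrixP => i j; rewrite mxE Omega_antisym [RHS]mxE.
  have S0 : S 0 0 *+ 2 = 0.
    by rewrite mulr2n -{1}[S]trmxK ST mxE mx_oppE addNr.
  move/eqP: S0; rewrite mulrn_eq0 /= => /eqP S0.
  by rewrite [S]sc S0 raddf0.
have adjvb : (conjv v) ^t* = v ^T.
  by apply/matrixP => i j; rewrite !mxE conjCK.
have [v0|v_neq0] := eqVneq (sqn v) 0.
  exists 0; rewrite mul0mx /besselmx v0 (adj_mul_eq0 v0).
  by rewrite scale0r /conjv map_mx0 !mulmx0 !mul0mx !subr0.
have BB : besselmx v *m (besselmx v) ^t* = sqn v *: besselmx v.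
  apply: bessel_sqr.
  - by rewrite conj_Creal // ger0_real.
  - rewrite [LHS]sc; congr (_%:M).
    rewrite /sqn !mxE; apply: eq_bigr => i _; rewrite !mxE conjCK.
    exact: mulrC.
  - have OO : (Omega R d) ^t* *m (Omega R d *m v) = v.
      by rewrite mulmxA adj_Omega_mul // mul1mx.
    by rewrite adjmxM -mulmxA OO [LHS]sc.
  - by rewrite adjvb mulmxA.
  - rewrite -[LHS]trmxCK adjmxM trmxCK adjvb mulmxA anti.
    by rewrite trmx0 map_mx0.
(* By [BB], dividing by the norm of v gives a factor whose Gram matrix is [besselmx v]. *)
exists ((sqrtC (sqn v))^-1 *: besselmx v).
rewrite adjmxZ -scalemxAl -scalemxAr scalerA BB scalerA -normCK.
rewrite ger0_norm ?invr_ge0 ?sqrtC_ge0 // exprVn sqrtCK mulVf ?scale1r //.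
Qed.

End SeparableCone.

(** * A complex projective 2-design from fourth roots of unity *)

Section Design.
Variable C : numClosedFieldType.

(* The bounds on p and q keep p - q from being a nonzero multiple of 4. *)
Lemma sum_fourth_roots (p q : nat) : (p <= 2)%N -> (q <= 2)%N ->
  \sum_(x < 4) (('i : C) ^+ x) ^+ p * (('i ^+ x)^*) ^+ q = 4 *+ (p == q).
Proof.
have ii := sqrCi C.
rewrite !big_ord_recl big_ord0 !rmorphXn /= conjCi /bump /=.
by move: p q => [|[|[|p]]] [|[|[|q]]] //= _ _; ring: ii.
Qed.

Lemma prod_exp_delta n (i : 'I_n) (F : 'I_n -> C) :
  \prod_t F t ^+ (t == i) = F i.
Proof.
rewrite (bigD1 i) //= eqxx expr1 big1 ?mulr1 // => t /negPf ->.
exact: expr0.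
Qed.

(** The sum over phase vectors factors over the coordinates t. Each factor is a sum over fourth
    roots of unity with both exponents at most 2, which vanishes unless the exponents agree. *)
Lemma phase_moment n (i j k l : 'I_n) :
  \sum_(f : {ffun 'I_n -> 'I_4})
    'i ^+ f i * ('i ^+ f j)^* * 'i ^+ f k * ('i ^+ f l)^* =
  (4 ^+ n) *+ [forall t : 'I_n, ((t == i) + (t == k) == (t == j) + (t == l))%N]
  :> C.
Proof.
transitivity (\sum_(f : {ffun 'I_n -> 'I_4}) \prod_t
   (('i ^+ f t) ^+ ((t == i) + (t == k)) *
    (('i ^+ f t)^*) ^+ ((t == j) + (t == l))) : C).
  apply: eq_bigr => f _; rewrite big_split /=.
  under [X in _ = X * _]eq_bigr => t _ do rewrite exprD.
  under [X in _ = _ * X]eq_bigr => t _ do rewrite exprD.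
  rewrite !big_split /= !(prod_exp_delta _ (fun t => 'i ^+ f t)).
  by rewrite !(prod_exp_delta _ (fun t => ('i ^+ f t)^*)); ring.
rewrite -(bigA_distr_bigA (fun t (x : 'I_4) =>
  (('i ^+ x) ^+ ((t == i) + (t == k)) *
   (('i ^+ x)^*) ^+ ((t == j) + (t == l))) : C)) /=.
transitivity (\prod_(t < n)
  ((4 : C) *+ ((t == i) + (t == k) == (t == j) + (t == l))%N)).
  by apply: eq_bigr => t _; rewrite sum_fourth_roots //;
    do 2!case: (_ == _).
case: (boolP (FiniteQuant.quant0b _)) => [/forallP h|/forallPn [t /negPf h]].
  by under eq_bigr => t _ do rewrite h; rewrite prodr_const card_ord.
by rewrite (bigD1 t) //= h mul0r.
Qed.

(** The quantified condition says that {i, k} and {j, l} agree as multisets. The two pairings on the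
    right count i = j = k = l twice, which the extra term on the left compensates. *)
Lemma pairing_deltas n (i j k l : 'I_n) :
  ([forall t : 'I_n, ((t == i) + (t == k) == (t == j) + (t == l))%N]
    + ((i == j) && (k == j) && (l == j)) =
   (i == j) * (k == l) + (i == l) * (k == j))%N.
Proof.
have [->|ij] := eqVneq i j.
  have [->|kl] := eqVneq k l.
    rewrite (_ : [forall t, _] = true); last by apply/forallP => t.
    by rewrite eq_sym; case: eqP.
  rewrite (_ : [forall t, _] = false) /=; last first.
    apply/negbTE/forallPn; exists k; rewrite eqxx (negPf kl).
    by case: (k == j).
  by case: (eqVneq k j) => [kj|]; case: (eqVneq l j) => [lj|];
    rewrite ?andbF //; move: kl; rewrite ?kj ?lj ?eqxx // eq_sym lj eqxx.
rewrite /= addn0 mul0n add0n.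
have [->|il] := eqVneq i l.
  have [->|kj] := eqVneq k j.
    by rewrite (_ : [forall t, _] = true) //; apply/forallP => t; rewrite addnC.
  rewrite (_ : [forall t, _] = false) //.
  apply/negbTE/forallPn; exists k; rewrite eqxx (negPf kj).
  by case: (k == l).
rewrite (_ : [forall t, _] = false) //.
apply/negbTE/forallPn; exists i; rewrite eqxx (negPf ij) (negPf il).
by case: (i == k).
Qed.

(* A complex projective 2-design. Vectors of fourth roots of unity give both
   pairings but count the term i = j = k = l only once; the standard basis
   vectors supply the missing one. *)
Lemma design n : exists s : seq 'cV[C]_n, forall i j k l,
  \sum_(v <- s) v i 0 * (v j 0)^* * v k 0 * (v l 0)^* =
  (i == j)%:R * (k == l)%:R + (i == l)%:R * (k == j)%:R.
Proof.
(* This scale makes c^4 cancel the factor 4^n of [phase_moment]. *)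
pose c : C := (sqrtC 2^-1) ^+ n.
have c_ge0 : 0 <= c by rewrite exprn_ge0 // sqrtC_ge0 invr_ge0 ler0n.
have cr : c^* = c by rewrite conj_Creal // ger0_real.
have c4 : c * c * c * c = 4 ^- n.
  have c2 : c ^+ 2 = 2^-1 ^+ n by rewrite /c exprAC sqrtCK.
  rewrite (_ : _ * _ = (c ^+ 2) ^+ 2); last by ring.
  by rewrite c2 exprAC -exprVn; congr (_ ^+ n); field.
clearbody c.
pose s1 := [seq \col_t (c * 'i ^+ (f t : 'I_4)) | f : {ffun 'I_n -> 'I_4}].
pose s2 := [seq (delta_mx m 0 : 'cV[C]_n) | m : 'I_n].
exists (s1 ++ s2) => i j k l; rewrite big_cat /= !big_image /=.
transitivity ([forall t : 'I_n,
    ((t == i) + (t == k) == (t == j) + (t == l))%N]%:R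
    + ((i == j) && (k == j) && (l == j))%:R : C); last first.
  by rewrite -!natrM -!natrD pairing_deltas.
congr (_ + _).
  transitivity (4 ^- n * \sum_(f : {ffun 'I_n -> 'I_4})
    'i ^+ f i * ('i ^+ f j)^* * 'i ^+ f k * ('i ^+ f l)^* : C).
    rewrite mulr_sumr; apply: eq_bigr => f _.
    by rewrite !mxE !rmorphM /= cr -c4; ring.
  rewrite phase_moment mulrnAr mulVf //.
  by rewrite expf_neq0 // pnatr_eq0.
rewrite (bigD1 j) //= big1 ?addr0.
  rewrite !mxE !eqxx !andbT !rmorph_nat -!natrM !mulnb.
  by congr (_ %:R); rewrite andbT.
move=> m /negPf mj; rewrite !mxE [j == m]eq_sym mj /= rmorph0.
by rewrite mulr0 !mul0r.
Qed.

End Design.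

(** * Generators of the cone, and the witness 1 - dP - Q *)

(** Used with e = d. The third matrix is (e - 1) - eP - Q, written as the difference in which the
    design averages produce it. *)
Lemma conePQ (K : comPzRingType) n (P Q : 'M[K]_n) (e x y z : K) :
  x *: (1%:M + e *: P) + y *: (1%:M + Q)
  + z *: ((e + 1) *: 1%:M - (1%:M + e *: P) - (1%:M + Q)) =
  (x + y + (e - 1) * z) *: 1%:M + (e * (x - z)) *: P + (y - z) *: Q.
Proof. by apply/matrixP => i j; rewrite !mxE; ring. Qed.

Lemma witnessPQ (K : comPzRingType) n (P Q : 'M[K]_n) (e c p q : K) :
    P *m P = P -> Q *m Q = 1%:M -> P *m Q = - P -> Q *m P = - P ->
  (1%:M - e *: P - Q) *m (c *: 1%:M + p *: P + q *: Q) =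
  (c - q) *: 1%:M + (2 * p - e * (c + p - q)) *: P + (q - c) *: Q.
Proof.
move=> PP QQ PQ QP.
rewrite !(mulmxDl, mulmxDr, mulNmx, =^~ scalemxAl, =^~ scalemxAr).
rewrite !mulmx1 !mul1mx PP QQ PQ QP.
by apply/matrixP => i j; rewrite !mxE; ring.
Qed.

Lemma mxtrace_rot (K : comPzRingType) n (W F W' X : 'M[K]_n) :
  \tr (W *m F *m W' *m X) = \tr (F *m (W' *m X *m W)).
Proof. by rewrite -!mulmxA mxtrace_mulC !mulmxA. Qed.

Lemma mxtrace_sub3 (K : comPzRingType) n (a : K) (X Y Z : 'M[K]_n) :
  \tr ((a *: 1%:M - X - Y) *m Z) = a * \tr Z - \tr (X *m Z) - \tr (Y *m Z).
Proof. by rewrite !mulmxBl -scalemxAl mul1mx !raddfB /= mxtraceZ. Qed.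

Section Witness.
Local Open Scope complex_scope.
Variables (R : realType) (d : nat).
Local Notation C := R[i].
Local Notation ix := mxtens_index.
Local Notation Om := (Omega R d).
Local Notation P := (Pproj R d).
Local Notation Q := (Qflip R d).
Local Notation V := (1%:M *t Om : 'M[C]_(d * d)).

Lemma psdmx_prodmx (v w : 'cV[C]_d) : psdmx (prodmx v w).
Proof. by rewrite /prodmx -tensmx_mul -adjmx_tens; apply: psdmx_mul_adj. Qed.

Lemma ptrans_prodmx (v w : 'cV[C]_d) : ptrans (prodmx v w) = prodmx v (conjv w).
Proof.
rewrite /prodmx ptrans_tens; congr (_ *t _); apply/matrixP => i j.
by rewrite !mxE; apply: eq_bigr => k _; rewrite !mxE conjCK mulrC.
Qed.

Lemma separable_psdmx (A : 'M[C]_(d * d)) : is_separable A -> psdmx A.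
Proof.
move=> [n [p [v [w [p0 _ _ ->]]]]]; apply: psdmx_sum => k.
by apply: psdmxZ => //; apply: psdmx_prodmx.
Qed.

Lemma separable_ppt (A : 'M[C]_(d * d)) : is_separable A -> is_ppt A.
Proof.
move=> [n [p [v [w [p0 _ _ ->]]]]]; rewrite /is_ppt.
rewrite [ptrans _](_ : _ = \sum_k (p k)%:C *: prodmx (v k) (conjv (w k))).
  apply: psdmx_sum => k.
  by apply: psdmxZ => //; apply: psdmx_prodmx.
have : ptrans (0 : 'M[C]_(d * d)) = 0 by apply/matrixP => x y; rewrite !mxE.
move/(big_morph (@ptrans R d) (@ptransD R d)) => ->.
by apply: eq_bigr => k _; rewrite ptransZ ptrans_prodmx.
Qed.

Lemma tr_Flip_tens (A B : 'M[C]_d) : \tr (Flip R d *m (A *t B)) = \tr (A *m B).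
Proof.
rewrite /mxtrace sum_mxtens exchange_big; apply: eq_bigr => k _.
by rewrite mxE; apply: eq_bigr => i _; rewrite Flip_mulmxE tensmxE.
Qed.

Lemma tr_Pproj_tens (A B : 'M[C]_d) :
  \tr (P *m (A *t B)) = d%:R^-1 * \tr (A^T *m B).
Proof.
rewrite /mxtrace sum_mxtens mulr_sumr; apply: eq_bigr => i _.
under eq_bigr => k _.
  rewrite mxE sum_mxtens.
  under eq_bigr => j _.
    under eq_bigr => l _.
      rewrite PprojE tensmxE [_ * _](_ : _ = (j == l)%:R *
        ((i == k)%:R * (d%:R^-1 * (A j i * B l k)))); last by ring.
    over.
    rewrite sum_delta.
  over.
  rewrite -mulr_sumr.
over.
rewrite sum_delta mxE mulr_sumr.
by apply: eq_bigr => j _; rewrite mxE.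
Qed.

Lemma tr_Qflip_tens (A B : 'M[C]_d) :
  \tr (Q *m (A *t B)) = \tr (Om *m A *m Om ^t* *m B).
Proof.
rewrite /Qflip mxtrace_rot adjmx_tens adjmx1 !tensmx_mul mul1mx mulmx1.
by rewrite tr_Flip_tens -mxtrace_rot.
Qed.

Hypotheses (hd : (4 <= d)%N) (hev : ~~ odd d).

(** The trace is w^* B w with B = [besselmx v]: Bessel's inequality for w against the orthogonal
    pair conj v, Omega v. *)
Lemma witness_prodmx (v w : 'cV[C]_d) :
  0 <= \tr ((1%:M - d%:R *: P - Q) *m prodmx v w).
Proof.
have [M BM] := besselmx_gram hev v.
have := psdmx_tr_ge0 (psdmx_congr w (psdmx_mul_adj M)).
rewrite -BM -mulmxA mxtrace_mulC -mulmxA => /le_trans; apply.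
rewrite /prodmx; set B := w *m _; set A := v *m _.
have vA : conjv v *m (conjv v) ^t* = A^T.
  apply/matrixP => i j; rewrite !mxE.
  by apply: eq_bigr => k _; rewrite !mxE conjCK mulrC.
have OA : Om *m v *m (Om *m v) ^t* = Om *m A *m Om ^t*.
  by rewrite adjmxM !mulmxA.
rewrite /besselmx vA OA mxtrace_sub3 -[_ 0 0]tr_outer -/A.
rewrite -[1%:M]scale1r mxtrace_sub3 mul1r -scalemxAl mxtraceZ mxtrace_tens.
by rewrite tr_Pproj_tens tr_Qflip_tens mulrA mulfV ?mul1r // d_neq0.
Qed.

End Witness.

(** * Necessary and sufficient conditions for separability *)

Section Separability.
Local Open Scope complex_scope.
Variables (R : realType) (d : nat).
Local Notation C := R[i].
Local Notation Om := (Omega R d).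
Local Notation P := (Pproj R d).
Local Notation Q := (Qflip R d).
Local Notation V := (1%:M *t Om : 'M[C]_(d * d)).
Hypotheses (hd : (4 <= d)%N) (hev : ~~ odd d).

Lemma separable_rho_le (a b : R) :
  is_separable (rho d a b) -> (d%:R + 1) * (a + b) <= 1.
Proof.
move=> [n [p [v [w [p0 _ _ rhoS]]]]].
have : 0 <= \tr ((1%:M - d%:R *: P - Q) *m rho d a b).
  rewrite rhoS mulmx_sumr raddf_sum /=; apply: sumr_ge0 => k _.
  by rewrite -scalemxAr mxtraceZ mulr_ge0 ?ler0c // witness_prodmx.
rewrite rhoE witnessPQ ?Pproj_sqr ?Qflip_sqr ?Pproj_Qflip ?Qflip_Pproj //.
rewrite !mxtraceD !mxtraceZ mxtrace1 tr_Pproj // tr_Qflip // mulr1.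
rewrite -(rmorph_nat (real_complex R) d) -(rmorph_nat (real_complex R) (d * d)).
rewrite -(rmorph_nat (real_complex R) 2).
rewrite -!(rmorphM, rmorphB, rmorphD) ler0c natrM.
have d0 : d%:R != 0 :> R by rewrite gt_eqF // d_gt0.
(* The trace against the witness carries the factor (d - 2)/d, which is positive, so the sign is
   that of 1 - (d + 1)(a + b). *)
rewrite [X in 0 <= X](_ : _ =
  (1 - (d%:R + 1) * (a + b)) * ((d%:R - 2) / d%:R)); last by field.
rewrite pmulr_lge0 ?subr_ge0 // divr_gt0 ?d_gt0 // subr_gt0.
by rewrite ltr_nat (leq_trans _ hd).
Qed.

Let outerE (v w : 'cV[C]_d) i j : (v *m w ^t*) i j = v i 0 * (w j 0)^*%R.
Proof. by rewrite mxE big_ord1 !mxE. Qed.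

(** Conjugating the second factor turns the two pairings of the design into 1 and dP. Without
    conjugation they are 1 and F, and V carries F to Q. *)
Lemma sepcone_generators : [/\ sepcone (1%:M + d%:R *: P), sepcone (1%:M + Q)
  & sepcone ((d%:R + 1) *: 1%:M - (1%:M + d%:R *: P) - (1%:M + Q))].
Proof.
have [s sE] := design C d.
have d0 := d_neq0 R hd.
have sP : \sum_(v <- s) prodmx v (conjv v) = 1%:M + d%:R *: P.
  apply: mxtensP => i k j l; rewrite -tensmx11 summxE mxE tensmxE mx_scaleE.
  rewrite PprojE mulVKf //.
  transitivity ((i == j)%:R * (l == k)%:R + (i == k)%:R * (l == j)%:R : C).
    rewrite -sE; apply: eq_bigr => v _; rewrite tensmxE !outerE !mxE conjCK.
    by ring.
  by rewrite !mxE [l == k]eq_sym [l == j]eq_sym.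
have sF : \sum_(v <- s) prodmx v v = 1%:M + Flip R d.
  apply: mxtensP => i k j l; rewrite -tensmx11 summxE mxE tensmxE FlipE.
  rewrite !mxE -sE; apply: eq_bigr => v _; rewrite tensmxE !outerE.
  exact: mulrA.
have sQ : \sum_(v <- s) prodmx v (Om *m v) = 1%:M + Q.
  transitivity (V *m (1%:M + Flip R d) *m V ^t*); last first.
    by rewrite mulmxDr mulmxDl mulmx1 V_mul_adj.
  rewrite -sF mulmx_sumr mulmx_suml; apply: eq_bigr => v _.
  rewrite /prodmx adjmx_tens adjmx1 !tensmx_mul mul1mx mulmx1.
  by congr (_ *t _); rewrite adjmxM !mulmxA.
(* Contracting k with l in the design identity: one pairing contributes d, the other 1. *)
have sN : \sum_(v <- s) (v *m v ^t*) *t ((v ^t* *m v) 0 0 *: (1%:M : 'M_d)) =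
    (d%:R + 1) *: 1%:M.
  apply: mxtensP => i k j l; rewrite -tensmx11 summxE mx_scaleE tensmxE.
  transitivity (\sum_(v <- s) \sum_m
      v i 0 * (v j 0)^*%R * v m 0 * (v m 0)^*%R * (k == l)%:R).
    apply: eq_bigr => v _; rewrite tensmxE outerE mx_scaleE [1%:M k l]mxE.
    rewrite mulrA -mulr_suml; congr (_ * _).
    rewrite [(_ *m _) 0 0]mxE mulr_sumr; apply: eq_bigr => m _.
    by rewrite !mxE; ring.
  rewrite exchange_big /=.
  under eq_bigr => m _ do rewrite -mulr_suml sE eqxx mulr1 [m == j]eq_sym.
  rewrite -mulr_suml big_split /= sumr_const card_ord sum_delta.
  by rewrite !mxE -mulr_natr [j == i]eq_sym; ring.
split.
- by rewrite -sP; apply: sepcone_sum => v; apply: sepcone_prodmx.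
- by rewrite -sQ; apply: sepcone_sum => v; apply: sepcone_prodmx.
have -> : (d%:R + 1) *: 1%:M - (1%:M + d%:R *: P) - (1%:M + Q) =
    \sum_(v <- s) (v *m v ^t*) *t besselmx v.
  rewrite -sN -sP -sQ -!sumrB; apply: eq_bigr => v _; apply: mxtensP => i k j l.
  by rewrite /besselmx 2!mx_subE !tensmxE 2!mx_subE !mulrBr.
apply: sepcone_sum => v; have [M ->] := besselmx_gram hev v.
exact: sepcone_gram.
Qed.

Lemma sepcone_rho (a b : R) :
    (d%:R + 1) * ((1 - d%:R) * a + b) <= 1 ->
    (d%:R + 1) * (a + (1 - d%:R) * b) <= 1 ->
    (d%:R + 1) * (a + b) <= 1 ->
  sepcone (rho d a b).
Proof.
move=> h1 h2 h3; have [g1 g2 g3] := sepcone_generators.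
have dp := d_gt0 R hd; have d0 : d%:R != 0 :> R by rewrite gt_eqF.
have d1 : d%:R + 1 != 0 :> R by rewrite gt_eqF // ltr_pwDr.
pose n : R := d%:R ^+ 2 * (d%:R + 1).
have n0 : 0 <= n by rewrite mulr_ge0 ?exprn_ge0 ?addr_ge0 // ltW.
(* The coefficients of rho on the three generators; up to the factor 1/n they are the slacks in the
   inequalities of S_1. *)
pose x := (1 - (d%:R + 1) * ((1 - d%:R) * a + b)) / n.
pose y := (1 - (d%:R + 1) * (a + (1 - d%:R) * b)) / n.
pose z := (1 - (d%:R + 1) * (a + b)) / n.
have [E1 E2 E3] : [/\ (1 - a - b) / d%:R ^+ 2 = x + y + (d%:R - 1) * z,
    a = d%:R * (x - z) & b / d%:R = y - z].
  by rewrite /x /y /z /n; split; field; rewrite ?d0 ?d1.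
have -> : rho d a b = x%:C *: (1%:M + d%:R *: P) + y%:C *: (1%:M + Q)
  + z%:C *: ((d%:R + 1) *: 1%:M - (1%:M + d%:R *: P) - (1%:M + Q)).
  rewrite conePQ rhoE E1 [X in X%:C *: P]E2 E3.
  by rewrite !(rmorphB, rmorphM, rmorphD, rmorph_nat, rmorph1).
by apply: sepconeD; [apply: sepconeD|]; apply: sepconeZ => //;
  rewrite divr_ge0 ?subr_ge0.
Qed.

End Separability.

(** * The regions with denominators cleared, and the theorem *)

Lemma S1_regionP (R : realType) (d : nat) (a b : R) :
  (a, b) \in S1_region d <->
  [/\ (d%:R + 1) * ((1 - d%:R) * a + b) <= 1,
      (d%:R + 1) * (a + (1 - d%:R) * b) <= 1
    & (d%:R + 1) * (a + b) <= 1].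
Proof.
have d1 : 0 < d%:R + 1 :> R by rewrite ltr_wpDl.
rewrite inE /S1_region /= !ler_pdivlMr //.
by rewrite ![_ * (d%:R + 1)]mulrC.
Qed.

Lemma T_regionP (R : realType) (d : nat) (a b : R) :
  (a, b) \in T_region d <->
  [/\ (d%:R + 1) * ((1 - d%:R) * a + b) <= 1,
      (d%:R + 1) * (a + (1 - d%:R) * b) <= 1,
      a + (1 + d%:R) * b <= 1
    & (1 + d%:R) * a + b <= 1].
Proof.
have d1 : 0 < d%:R + 1 :> R by rewrite ltr_wpDl.
rewrite inE /T_region /= !ler_pdivlMr //.
by rewrite ![_ * (d%:R + 1)]mulrC.
Qed.

Lemma is_state_rho (R : realType) (d : nat) (a b : R) :
  (4 <= d)%N -> ~~ odd d -> is_state (rho d a b) <-> psdmx (rho d a b).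
Proof. by move=> hd hev; split=> [[]|] // psd; split=> //; apply: tr_rho. Qed.

Theorem theorem4p1 (R : realType) (d : nat) (hd : (4 <= d)%N)
    (hev : ~~ odd d) :
  [/\ forall a b : R,
        (is_state (rho d a b) /\ is_separable (rho d a b))
          <-> (a, b) \in S1_region d,
      forall a b : R,
        (is_state (rho d a b) /\ is_ppt (rho d a b))
          <-> (a, b) \in T_region d
    & forall a b : R,
        1 / (d%:R + 1) < a + b ->
        a + (1 + d%:R) * b <= 1 ->
        (1 + d%:R) * a + b <= 1 ->
        [/\ is_state (rho d a b), is_ppt (rho d a b)
          & is_entangled (rho d a b)]].
Proof.
have d4 : 4 <= d%:R :> R by rewrite ler_nat.
have sepP (a b : R) : (is_state (rho d a b) /\ is_separable (rho d a b)) <->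
    (a, b) \in S1_region d.
  rewrite S1_regionP; split=> [[_ sep]|[h1 h2 h3]].
    have [_ l1] := psdmx_rho_inv hd hev (separable_psdmx sep).
    have /(is_ppt_rho hd hev a b) psd' := separable_ppt sep.
    have [_ l2] := psdmx_rho_inv hd hev psd'.
    have h3 := separable_rho_le hd hev sep.
    (* The first two inequalities are [l1] and [l2], with 1 - d^2 factored. *)
    by split=> //; nra.
  have sep : is_separable (rho d a b).
    apply: sepcone_separable; last exact: tr_rho.
      by rewrite (leq_trans _ hd).
    exact: sepcone_rho.
  by split=> //; apply/is_state_rho => //; apply: separable_psdmx.
have pptP (a b : R) : (is_state (rho d a b) /\ is_ppt (rho d a b)) <->
    (a, b) \in T_region d.
  rewrite T_regionP is_state_rho // is_ppt_rho //.
  split=> [[psd psd']|[h1 h2 h3 h4]].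
    have [l1 l2] := psdmx_rho_inv hd hev psd.
    have [l3 l4] := psdmx_rho_inv hd hev psd'.
    by split; nra.
  (* The eigenvalue on the range of (1 + Q)/2 is covered by [h2], and by [h1] after the exchange of
     a and b, as 1/(d + 1) <= 1. *)
  by split; apply: psdmx_rho => //; nra.
split=> // a b; rewrite ltr_pdivrMr; last by lra.
move=> gt1 h3 h4.
(* Comparing [gt1] with [h3] and [h4] gives a > 0 and b > 0. Subtracting d^2 a from the left side of
   [h3], and d^2 b from that of [h4], then yields the other two inequalities of T. *)
have [|st ppt] := (pptP a b).2; first by apply/T_regionP; split=> //; nra.
split=> // sep; have /sepP/S1_regionP[_ _] := conj st sep.
by rewrite leNgt mulrC gt1.
Qed.
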